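(* Let $A > 1$ be an arbitrary constant and let $I = [1/A, A]$. Then the linear operator $T[f](x) = 2 f(\sqrt{x})$, $x \in I$, is a strict global contraction on the complete metric space $(\mathcal{M}(I,\mathbb{R}), d)$ with contraction constant $\kappa = 1/2$; that is, $T$ maps $\mathcal{M}(I,\mathbb{R})$ into itself and $$d(T[f_1], T[f_2]) \leqslant \tfrac{1}{2}\, d(f_1, f_2) \qquad \text{for all } f_1, f_2 \in \mathcal{M}(I,\mathbb{R}).$$ Consequently, $T$ admits a unique fixed point in $\mathcal{M}(I,\mathbb{R})$, and this fixed point is the natural logarithm $x \mapsto \log x$ on $I$.
   Context: For $I = [1/A, A]$ with $A > 1$, let $\mathcal{B}(I,\mathbb{R})$ be the vector space of all continuous functions $h : I \to \mathbb{R}$ such that $h(1) = 0$ and $$\|h\|_{\mathcal{B}} := \sup_{x \in I \setminus \{1\}} \frac{|h(x)|\, x}{(x-1)^2} < +\infty ,$$ normed by $\|\cdot\|_{\mathcal{B}}$. Let $f_0(x) = x - 1$ and define the affine space $$\mathcal{M}(I,\mathbb{R}) := \{ f : I \to \mathbb{R} \;:\; f - f_0 \in \mathcal{B}(I,\mathbb{R}) \},$$ equipped with the metric $d(f_1, f_2) = \|f_1 - f_2\|_{\mathcal{B}}$. Note that $\sqrt{x} \in I$ for every $x \in I$, so $T[f]$ is well defined on $I$. *)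

(* Defs.v *)
From HB Require Import structures.
From mathcomp Require Import all_boot all_order all_algebra.
From mathcomp Require Import all_classical all_reals all_analysis.

Set Implicit Arguments.
Unset Strict Implicit.
Unset Printing Implicit Defensive.

Import Order.TTheory GRing.Theory Num.Theory.
Import numFieldNormedType.Exports.
Local Open Scope classical_set_scope.
Local Open Scope ring_scope.

(* As a type, [Itv A] is the library's subtype of the set, with the topology
   induced by that of [R]; functions on the interval are honest functions on
   that subtype, so equality of functions is equality on the interval. *)
Definition Itv (R : realType) (A : R) : set R := `[A^-1, A].

Section function_space.
Context {R : realType} (A : R).
Implicit Types f g h : Itv A -> R.

Definition normB h : \bar R :=
  ereal_sup [set (`|h x| * \val x / (\val x - 1) ^+ 2)%:E
            | x in [set x : Itv A | \val x != 1]].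

Definition spaceB : set (Itv A -> R) :=
  [set h | [/\ continuous h,
               (forall x : Itv A, \val x = 1 -> h x = 0)
             & (normB h < +oo)%E]].

Definition f0 : Itv A -> R := fun x => \val x - 1.

Definition setM : set (Itv A -> R) := [set f | spaceB (f \- f0)].

(* The norm is finite on differences of elements of [setM], see
   [normB_fin_num] below; elsewhere [fine] sends infinities to 0. *)
Definition distB f g : R := fine (normB (f \- g)).

End function_space.

Section metric_space.
Context {R : realType} (A : R) (A1 : 1 < A).
Implicit Types f g h : Itv A -> R.

Let A0 : 0 < A. Proof. exact: lt_trans A1. Qed.

Lemma Itv_gt0 (x : Itv A) : 0 < \val x.
Proof.
case: x => x /= /set_mem; rewrite /Itv/= in_itv/= => /andP[Ax _].
by apply: lt_le_trans Ax; rewrite invr_gt0.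
Qed.

Lemma sqrt_Itv (x : Itv A) : Num.sqrt (\val x) \in Itv A.
Proof.
have x0 := Itv_gt0 x.
case: x x0 => x /= xI x0; move/set_mem: xI.
rewrite /Itv/= in_itv/= => /andP[Ax xA].
apply/mem_set; rewrite /Itv/= in_itv/=; apply/andP; split.
- rewrite -(@ler_pXn2r _ 2) ?nnegrE ?sqrtr_ge0 ?invr_ge0 ?(ltW A0)//.
  rewrite sqr_sqrtr ?(ltW x0)//; apply: le_trans Ax.
  by rewrite expr2 ler_piMr ?invr_ge0 ?(ltW A0)// invf_le1// ltW.
- rewrite -(@ler_pXn2r _ 2) ?nnegrE ?sqrtr_ge0 ?(ltW A0)//.
  rewrite sqr_sqrtr ?(ltW x0)//; apply: le_trans xA _.
  by rewrite expr2 ler_peMr ?(ltW A0)// ltW.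
Qed.

Definition sqrtI (x : Itv A) : Itv A := exist _ (Num.sqrt (\val x)) (sqrt_Itv x).

Definition opT f : Itv A -> R := fun x => 2 * f (sqrtI x).

Let A_Itv : A \in Itv A.
Proof.
apply/mem_set; rewrite /Itv/= in_itv/= lexx andbT.
by rewrite (le_trans _ (ltW A1))// invf_le1// ltW.
Qed.

Let weight_ge0 h (x : Itv A) : 0 <= `|h x| * \val x / (\val x - 1) ^+ 2.
Proof. by rewrite divr_ge0 ?sqr_ge0// mulr_ge0// ltW// Itv_gt0. Qed.

Lemma normB_ge0 h : (0 <= normB h)%E.
Proof.
pose a : Itv A := exist _ A A_Itv.
apply: (@le_trans _ _ (`|h a| * \val a / (\val a - 1) ^+ 2)%:E).
  by rewrite lee_fin weight_ge0.
apply: ereal_sup_ubound; exists a => //=.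
by rewrite gt_eqF.
Qed.

Lemma normBN h : normB (\- h) = normB h.
Proof.
by congr ereal_sup; apply/seteqP; split => _ [x x1 <-]; exists x => //=;
  rewrite normrN.
Qed.

Lemma normB_triangle f g : (normB (f \+ g)%R <= normB f + normB g)%E.
Proof.
apply: ge_ereal_sup => _ [x x1 <-].
pose w (h : Itv A -> R) := `|h x| * \val x / (\val x - 1) ^+ 2.
apply: (@le_trans _ _ ((w f)%:E + (w g)%:E)%E).
  rewrite -EFinD lee_fin -!mulrDl !ler_wpM2r ?invr_ge0 ?sqr_ge0//=.
    by rewrite ltW// Itv_gt0.
  exact: ler_normD.
by apply: leeD; apply: ereal_sup_ubound; exists x.
Qed.

Lemma normB_fin_num f g : setM f -> setM g -> normB (f \- g) \is a fin_num.
Proof.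
move=> [_ _ fM] [_ _ gM]; rewrite ge0_fin_numE ?normB_ge0//.
have -> : f \- g = (f \- @f0 _ A) \+ \- (g \- @f0 _ A).
  by apply/funext => x /=; move: (f0 x) => c; rewrite opprB addrA subrK.
apply: (le_lt_trans (normB_triangle _ _)).
by rewrite normBN lte_add_pinfty.
Qed.

Lemma f0_setM : setM (@f0 _ A).
Proof.
have -> : setM (@f0 R A) = spaceB (cst 0 : Itv A -> R).
  by congr spaceB; apply/funext => x /=; rewrite subrr.
split => //; first by move=> x; exact: cst_continuous.
apply: (@le_lt_trans _ _ 0%E); last exact: ltry.
by apply: ge_ereal_sup => _ [x _ <-] /=; rewrite normr0 !mul0r.
Qed.

(* A copy of the subtype of [setM], so that it carries the metric [distB] and
   not the topology induced by a topology on the ambient function type. *)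
Definition spaceM of 1 < A : Type := {f : Itv A -> R | f \in @setM R A}.

Local Notation M := (spaceM A1).

HB.instance Definition _ := Choice.copy M {f : Itv A -> R | f \in @setM R A}.

Implicit Types u v w : M.

Definition distM u v : R := distB (sval u) (sval v).

Let distMxx u : distM u u = 0.
Proof.
rewrite /distM /distB.
have -> : sval u \- sval u = cst 0 by apply/funext => x /=; rewrite subrr.
suff -> : normB (cst 0 : Itv A -> R) = 0%E by [].
apply/eqP; rewrite eq_le normB_ge0 andbT.
by apply: ge_ereal_sup => _ [x _ <-] /=; rewrite normr0 !mul0r.
Qed.

Let distM_positivity u v : distM u v = 0 -> u = v.
Proof.
case: u v => [f fM'] [g gM'].
have fM := set_mem fM'; have gM := set_mem gM'.
rewrite /distM /distB/= => fg0; apply: eq_exist.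
have {}fg0 : normB (f \- g) = 0%E.
  by rewrite -(fineK (normB_fin_num fM gM)) fg0.
apply/funext => x; have [x1|x1] := eqVneq (\val x) 1.
  case: fM gM => [_ /(_ _ x1)/= f1 _] [_ /(_ _ x1)/= g1 _].
  by apply: (@addIr _ (- f0 x)); rewrite f1 g1.
apply/eqP; rewrite -subr_eq0 -normr_eq0.
have : `|f x - g x| * \val x / (\val x - 1) ^+ 2 = 0.
  apply/eqP; rewrite eq_le (weight_ge0 (f \- g)) andbT.
  have : ((`|f x - g x| * \val x / (\val x - 1) ^+ 2)%:E <=
          normB (f \- g)%R)%E.
    by apply: ereal_sup_ubound; exists x.
  by rewrite fg0 lee_fin.
move/eqP; rewrite !mulf_eq0 invr_eq0 expf_eq0/= subr_eq0 (negbTE x1) orbF.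
by rewrite (gt_eqF (Itv_gt0 x)) orbF.
Qed.

Let distM_sym u v : distM u v = distM v u.
Proof.
rewrite /distM /distB -normBN; congr (fine (normB _)).
by apply/funext => x /=; rewrite opprB.
Qed.

Let distM_triangle v u w : distM u w <= distM u v + distM v w.
Proof.
case: u v w => [f fM'] [g gM'].
case=> [h hM']; rewrite /distM /distB/=.
have fM := set_mem fM'; have gM := set_mem gM'; have hM := set_mem hM'.
rewrite -fineD ?normB_fin_num// fine_le ?fin_numD ?normB_fin_num//.
have -> : f \- h = (f \- g) \+ (g \- h).
  by apply/funext => x /=; rewrite addrA subrK.
exact: normB_triangle.
Qed.

HB.instance Definition _ := isMetric.Build R M
  distMxx distM_positivity distM_sym distM_triangle.

HB.instance Definition _ :=
  isPointed.Build M (exist _ (@f0 R A) (mem_set f0_setM)).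

End metric_space.

(* Main.v *)
(* Let w(x) = (x - 1)^2 / x.  A bound ||h|| <= c means |h| <= c w, and with
   y = sqrt x we have w(x) = w(y) (y + 1)^2 / y >= 4 w(y); hence
   |2 h(y)| <= 2 c w(y) <= (c / 2) w(x).  The inequalities
   1 - 1/x <= ln x <= x - 1 give |ln x - (x - 1)| <= w(x), so ln is a fixed
   point of T lying in M; it is unique by contraction, and
   T f = ln + T (f - ln) shows that T preserves M.  As w is bounded on I,
   d-limits are uniform limits, whence completeness. *)

Require Import Defs.
From mathcomp Require Import all_boot all_order all_algebra.
From mathcomp Require Import all_classical all_reals all_analysis.
From mathcomp Require Import ring lra.

Set Implicit Arguments.
Unset Strict Implicit.
Unset Printing Implicit Defensive.

Import Order.TTheory GRing.Theory Num.Theory.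
Import numFieldNormedType.Exports.
Local Open Scope classical_set_scope.
Local Open Scope ring_scope.

(** * Elementary estimates for the weight *)

Section weight.
Context {R : realType}.
Implicit Types x y c : R.

Definition weight x : R := (x - 1) ^+ 2 / x.

Lemma weight_ge0 x : 0 < x -> 0 <= weight x.
Proof. by move=> x0; rewrite divr_ge0 ?sqr_ge0// ltW. Qed.

Lemma weight1 : weight 1 = 0.
Proof. by rewrite /weight subrr expr0n mul0r. Qed.

(* Writing [x = y ^+ 2], this is AM-GM: [4 y <= (y + 1) ^+ 2]. *)
Lemma weight_sqrt x : 0 < x -> 4 * weight (Num.sqrt x) <= weight x.
Proof.
move=> x0; have y0 : 0 < Num.sqrt x by rewrite sqrtr_gt0.
rewrite -[in leRHS](sqr_sqrtr (ltW x0)); move: (Num.sqrt x) y0 => y y0.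
rewrite -subr_ge0.
have -> : weight (y ^+ 2) - 4 * weight y = ((y - 1) ^+ 2 / y) ^+ 2.
  by rewrite /weight; field; rewrite gt_eqF.
exact: sqr_ge0.
Qed.

(** The bound [ln y <= y - 1] at [y = x] and at [y = x^-1] encloses [ln x - (x - 1)] between
    [- weight x] and 0, because [weight x] is the sum of the two right-hand sides. *)
Lemma ln_weight x : 0 < x -> `|ln x - (x - 1)| <= weight x.
Proof.
move=> x0; have xV0 : 0 < x^-1 by rewrite invr_gt0.
have lnle y : 0 < y -> ln y <= y - 1.
  by move=> y0; rewrite -[X in ln X](subrKC 1) le_ln1Dx//; lra.
have := lnle _ xV0; rewrite lnV ?posrE// => lnx.
have wE : weight x = x - 1 + (x^-1 - 1).
  by rewrite /weight; field; rewrite gt_eqF.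
rewrite ler0_norm ?subr_le0 ?lnle// wE; lra.
Qed.

(** Here [(x - 1) ^+ 2 <= A ^+ 2] and [x^-1 <= A]. *)
Lemma weight_le (A : R) x : 1 < A -> x \in `[A^-1, A] -> weight x <= A ^+ 3.
Proof.
rewrite in_itv/= => A1 /andP[Ax xA]; have A0 : 0 < A by exact: lt_trans A1.
have x0 : 0 < x by rewrite (lt_le_trans _ Ax)// invr_gt0.
rewrite exprSr; apply: ler_pM => //; rewrite ?sqr_ge0 ?invr_ge0 ?(ltW x0)//.
  by rewrite -subr_ge0 subr_sqr mulr_ge0//; lra.
by rewrite invf_ple ?posrE.
Qed.

End weight.

(** * The norm as a pointwise bound, and the vector space it defines *)

Section weighted_norm.
Context {R : realType} (A : R) (A1 : 1 < A).
Implicit Types (f g h : Itv A -> R) (x : Itv A) (c : R).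

Let x_gt0 x : 0 < \val x := Itv_gt0 A1 x.

Lemma normB_leP h c : (normB h <= c%:E)%E <->
  forall x, \val x != 1 -> `|h x| <= c * weight (\val x).
Proof.
have quotE x : \val x != 1 ->
    (`|h x| * \val x / (\val x - 1) ^+ 2 <= c) = (`|h x| <= c * weight (\val x)).
  move=> x1; have d0 : 0 < (\val x - 1) ^+ 2.
    by rewrite lt_neqAle sqr_ge0 andbT eq_sym expf_eq0/= subr_eq0.
  by rewrite ler_pdivrMr// /weight mulrA ler_pdivlMr.
split=> [hc x x1|hc].
  rewrite -quotE// -lee_fin; apply: le_trans hc.
  by apply: ereal_sup_ubound; exists x.
by apply: ge_ereal_sup => _ [x x1 <-]; rewrite lee_fin quotE// hc.
Qed.

Lemma weight_bounded : exists C, forall x, weight (\val x) <= C.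
Proof.
exists (A ^+ 3) => x; apply: weight_le => //.
by have := set_mem (valP x).
Qed.

Lemma normB_fineK h : spaceB h -> normB h = (fine (normB h))%:E.
Proof.
by move=> [_ _ hoo]; rewrite fineK// ge0_fin_numE// normB_ge0.
Qed.

(** The supremum omits the point 1, but there both sides vanish. *)
Lemma spaceB_ptwise h x : spaceB h -> `|h x| <= fine (normB h) * weight (\val x).
Proof.
move=> hB; have [_ h1 _] := hB; have [x1|] := eqVneq (\val x) 1.
  by rewrite h1// x1 weight1 normr0 mulr0.
by move: x; apply/normB_leP; rewrite -normB_fineK.
Qed.

(** The weight vanishes at 1, so one bound at all points yields both [h 1 = 0] and the finite
    norm. *)
Lemma spaceB_bounded h c : continuous h ->
  (forall x, `|h x| <= c * weight (\val x)) -> spaceB h.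
Proof.
move=> hcont hc; split => //.
  move=> x x1; apply/eqP.
  by rewrite -normr_le0 (le_trans (hc x))// x1 weight1 mulr0.
by apply: (@le_lt_trans _ _ c%:E); [exact/normB_leP|exact: ltry].
Qed.

Lemma spaceBD f g : spaceB f -> spaceB g -> spaceB (f \+ g).
Proof.
move=> fB gB; have [[fc _ _] [gc _ _]] := (fB, gB).
apply: (@spaceB_bounded _ (fine (normB f) + fine (normB g))).
  by move=> x; apply: continuousD; [exact: fc|exact: gc].
by move=> x; rewrite mulrDl (le_trans (ler_normD _ _))// lerD// spaceB_ptwise.
Qed.

Lemma spaceBN f : spaceB f -> spaceB (\- f).
Proof.
move=> fB; have [fc _ _] := fB.
apply: (@spaceB_bounded _ (fine (normB f))); first by move=> x; apply: continuousN; exact: fc.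
by move=> x /=; rewrite normrN spaceB_ptwise.
Qed.

Lemma setMB f g : setM f -> setM g -> spaceB (f \- g).
Proof.
move=> fM gM; have -> : f \- g = (f \- @f0 _ A) \+ \- (g \- @f0 _ A).
  by apply/funext => x /=; ring.
by apply: spaceBD => //; exact: spaceBN.
Qed.

Lemma setMD f h : setM f -> spaceB h -> setM (f \+ h).
Proof.
move=> fM hB; rewrite /setM/=.
have -> : (f \+ h) \- @f0 _ A = (f \- @f0 _ A) \+ h.
  by apply/funext => x /=; ring.
exact: spaceBD.
Qed.

Lemma distB_ge0 f g : 0 <= distB f g.
Proof. by rewrite fine_ge0// normB_ge0. Qed.

Lemma distB_le f g c : setM f -> setM g ->
  (forall x, `|f x - g x| <= c * weight (\val x)) -> distB f g <= c.
Proof.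
move=> fM gM fgc; rewrite -lee_fin -normB_fineK; last exact: setMB.
by apply/normB_leP => x _; exact: fgc.
Qed.

Lemma distB_ptwise f g x : setM f -> setM g ->
  `|f x - g x| <= distB f g * weight (\val x).
Proof.
by move=> fM gM; apply: (@spaceB_ptwise (f \- g)); exact: setMB.
Qed.

Lemma distB_eq0 f g : setM f -> setM g -> distB f g <= 0 -> f = g.
Proof.
move=> fM gM fg; apply/funext => x; apply/eqP; rewrite -subr_eq0 -normr_le0.
by rewrite (le_trans (distB_ptwise x fM gM))// mulr_le0_ge0// weight_ge0.
Qed.

(** * The operator: continuity, contraction, invariance and the fixed point *)

Lemma continuous_Itv (phi : R -> R) : (forall x : R, 0 < x -> {for x, continuous phi}) ->
  continuous (phi \o \val : Itv A -> R).
Proof.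
move=> phic x; apply: continuous_comp; last exact/phic/x_gt0.
exact: initial_continuous.
Qed.

(** The interval carries the initial topology of [\val], so it suffices that the composite with
    [\val] is continuous. *)
Lemma sqrtI_continuous : continuous (sqrtI A1).
Proof.
apply: continuous_comp_initial.
by apply: (@continuous_Itv Num.sqrt) => x _; exact: sqrt_continuous.
Qed.

(** The operator contributes a factor 2 and [weight_sqrt] a factor 1/4; together they give the
    contraction constant. *)
Lemma opT_le h c : (forall x, `|h x| <= c * weight (\val x)) -> 0 <= c ->
  forall x, `|opT A1 h x| <= 2^-1 * c * weight (\val x).
Proof.
move=> hc c0 x; rewrite /opT normrM ger0_norm//.
have := hc (sqrtI A1 x); have := weight_sqrt (x_gt0 x) => /=.
move: (weight _) (weight _) => w v vw hw.
apply: (@le_trans _ _ (2 * (c * v))); first by rewrite ler_pM2l.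
have -> : 2 * (c * v) = 2^-1 * c * (4 * v) by field.
by rewrite ler_wpM2l// mulr_ge0// invr_ge0.
Qed.

Lemma opT_continuous h : continuous h -> continuous (opT A1 h).
Proof.
move=> hc x; apply: (@continuousM _ _ (cst 2)); first exact: cst_continuous.
by apply: (@continuous_comp _ _ _ (sqrtI A1) h); [exact: sqrtI_continuous|exact: hc].
Qed.

Lemma opT_linear : linear (opT A1 : (Itv A -> R^o) -> (Itv A -> R^o)).
Proof.
move=> k f g; apply/funext => x; rewrite /opT/= !fctE /GRing.scale/=; ring.
Qed.

Lemma spaceB_opT h : spaceB h -> spaceB (opT A1 h).
Proof.
move=> hB; have [hc _ _] := hB.
apply: (spaceB_bounded (opT_continuous hc) (opT_le _ _)).
  by move=> x; exact: spaceB_ptwise.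
by rewrite fine_ge0// normB_ge0.
Qed.

Lemma ln_setM : setM (fun x => ln (\val x)).
Proof.
apply: (@spaceB_bounded _ 1); last first.
  by move=> x; rewrite mul1r; exact/ln_weight/x_gt0.
have := @continuous_Itv (fun z => ln z - (z - 1)); apply => z z0.
apply: continuousB; first exact: continuous_ln.
by apply: continuousB; [exact: cvg_id|exact: cst_continuous].
Qed.

Lemma opT_ln : opT A1 (fun x => ln (\val x)) = (fun x => ln (\val x)).
Proof.
apply/funext => x; rewrite /opT/=.
have y0 : 0 < Num.sqrt (\val x) by rewrite sqrtr_gt0.
rewrite mulr_natl -lnXn// sqr_sqrtr//; exact/ltW/x_gt0.
Qed.

(** The base point [f0] is not fixed by the operator, so [f] is expanded around [ln], which is;
    additivity leaves a remainder in [spaceB]. *)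
Lemma setM_opT f : setM f -> setM (opT A1 f).
Proof.
move=> fM; rewrite -[f](_ : (fun x => ln (\val x)) \+ (f \- (fun x => ln (\val x))) = f).
  have -> g h : opT A1 (g \+ h) = opT A1 g \+ opT A1 h.
    by apply/funext => x; rewrite /opT/= mulrDr.
  rewrite opT_ln; apply: setMD; first exact: ln_setM.
  by apply: spaceB_opT; apply: setMB => //; exact: ln_setM.
by apply/funext => x /=; ring.
Qed.

Lemma opT_contraction f g : setM f -> setM g ->
  distB (opT A1 f) (opT A1 g) <= 2^-1 * distB f g.
Proof.
move=> fM gM; apply: distB_le; [exact: setM_opT|exact: setM_opT|move=> x].
have -> : opT A1 f x - opT A1 g x = opT A1 (f \- g) x by rewrite /opT/= mulrBr.
apply: opT_le; last exact: distB_ge0.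
by move=> y; exact: distB_ptwise.
Qed.

End weighted_norm.

(** * Completeness of the metric space *)

Section completeness.
Context {R : realType} (A : R) (A1 : 1 < A).
Local Notation M := (spaceM A1).
Implicit Types (u v : M) (e : R).

Let svalM u : setM (sval u) := set_mem (svalP u).

Lemma ball_spaceM u v e : ball u e v = (distB (sval u) (sval v) < e) :> Prop.
Proof. by rewrite ballEmdist. Qed.

Lemma ball_ptwise u v e (x : Itv A) : ball u e v ->
  `|sval u x - sval v x| <= e * weight (\val x).
Proof.
rewrite ball_spaceM => uv; rewrite (le_trans (distB_ptwise A1 x _ _))//.
by apply: ler_wpM2r; [exact/weight_ge0/(Itv_gt0 A1)|exact: ltW].
Qed.

Lemma spaceM_complete (F : set_system M) : ProperFilter F -> cauchy F -> cvg F.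
Proof.
move=> FF /cauchyP Fc; have w0 (x : Itv A) : 0 <= weight (\val x).
  by rewrite weight_ge0// (Itv_gt0 A1).
have evc (x : Itv A) : cvg ((fun u => sval u x) @ F).
  apply: cauchy_cvg; apply: cauchy_exP => e e0.
  (* Adding 1 keeps the divisor positive at the point 1 and makes the final bound strict. *)
  have d0 : 0 < weight (\val x) + 1 by rewrite ltr_wpDl.
  have [u Fu] := Fc _ (divr_gt0 e0 d0); exists (sval u x).
  apply: (@filterS _ F _ _ _ _ Fu) => v /(ball_ptwise x) uv.
  rewrite -ball_normE/=; apply: le_lt_trans uv _.
  by rewrite mulrAC ltr_pdivrMr// ltr_pM2l// ltrDl.
pose L x := lim ((fun u => sval u x) @ F).
(* Passage to the limit in [v] in the bound on [sval v x - sval u x]; the slack [d] covers the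
   distance from [sval v x] to its limit. *)
have LP u e x : F (ball u e) -> `|L x - sval u x| <= e * weight (\val x).
  move=> Fu; apply/ler_addgt0Pr => d d0.
  have /cvgrPdist_lt/(_ _ d0) Fd := evc x.
  have [v [/= Ld /(ball_ptwise x) uv]] := filter_ex (filterI Fd Fu).
  rewrite [leRHS]addrC -(subrKA (sval v x)) (le_trans (ler_normD _ _))//.
  by apply: lerD; [exact: ltW|rewrite distrC].
have LB u e : F (ball u e) -> spaceB (L \- sval u).
  move=> Fu; apply: (@spaceB_bounded _ _ A1 _ e); last by move=> x; exact: LP.
  (* Membership in [setM] gives continuity of differences, hence the comparison with a fixed [u]. *)
  have ucont v : continuous (sval v \- sval u).
    by case: (setMB A1 (svalM v) (svalM u)).
  have [C C_ge] := weight_bounded A1.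
  have C0 : 0 < `|C| + 1 by rewrite ltr_wpDl.
  move=> x; apply/(@cvgrPdist_le _ _ _ (nbhs x) (nbhs_filter x)) => d d0.
  have d3 : 0 < d / 3 by rewrite divr_gt0.
  (* This radius times the weight is at most [d / 3] at every point: [sval v] is uniformly close to
     [L], and a three-term estimate gives continuity. *)
  have [v Fv] := Fc _ (divr_gt0 d3 C0).
  have Lv y : `|L y - sval v y| <= d / 3.
    apply: le_trans (LP _ _ y Fv) _; rewrite mulrAC ler_pdivrMr// ler_pM2l//.
    by rewrite (le_trans (C_ge y))// (le_trans (ler_norm _))// lerDl.
  have /(@cvgrPdist_le _ _ _ (nbhs x) (nbhs_filter x))/(_ _ d3) := ucont v x.
  apply: filterS => y /= uxy; have := Lv x; have := Lv y; move: uxy.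
  by rewrite !ler_norml => *; lra.
have LM : setM L.
  have [u Fu] := Fc _ (@ltr01 R).
  rewrite -[L](_ : sval u \+ (L \- sval u) = L); last by apply/funext => x /=; ring.
  by apply: setMD => //; exact: LB Fu.
apply/cvg_ex; exists (exist _ L (mem_set LM)).
move=> U /nbhs_ballP[e /= e0 eU].
have e3 : 0 < e / 3 by rewrite divr_gt0.
have [u Fu] := Fc _ e3.
apply: filterS (Fu) => v uv; apply: eU; rewrite ball_spaceM/=.
(* Pointwise bounds control the distance only non-strictly, so two thirds of [e] leave room for the
   open ball. *)
apply: (@le_lt_trans _ _ (e / 3 + e / 3)); last lra.
apply: distB_le => // x; rewrite -(subrKA (sval u x)) mulrDl.
by rewrite (le_trans (ler_normD _ _))// lerD// ?LP// ball_ptwise.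
Qed.
End completeness.

Theorem theorem3 (R : realType) (A : R) (A1 : 1 < A) :
  let T := opT A1 in
  let M := @setM R A in
  let log : Itv A -> R := fun x => ln (\val x) in
  linear (T : (Itv A -> R^o) -> (Itv A -> R^o)) /\
  (forall F : set_system (spaceM A1), ProperFilter F -> cauchy F -> cvg F) /\
  (forall f, M f -> M (T f)) /\
  (forall f1 f2, M f1 -> M f2 -> distB (T f1) (T f2) <= 2^-1 * distB f1 f2) /\
  (exists! f, M f /\ T f = f) /\
  (M log /\ T log = log).
Proof.
move=> T M log; have logM : M log by exact: ln_setM.
have Tlog : T log = log by exact: opT_ln.
split; first exact: opT_linear.
split; first exact: spaceM_complete.
split; first exact: setM_opT.
split; first exact: opT_contraction.
split; last by [].
exists log; split=> // f [fM Tf]; apply: (distB_eq0 A1) => //.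
(* Between two fixed points the contraction reads [d <= d / 2], which forces [d <= 0]. *)
have := opT_contraction A1 logM fM; rewrite -/T Tlog Tf; lra.
Qed.
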